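(* Consider the multi-agent system $\dot{x} = (I_N\otimes A)x + (I_N\otimes B)u$, $x(0)=x_0$, with agent state matrices $A\in\mathbb{R}^{n\times n}$, $B\in\mathbb{R}^{n\times m}$, where the pair $(A,B)$ is stabilizable, and with given real weighting matrices $Q\ge 0$ (size $n\times n$) and $R>0$ (size $m\times m$). Assume that the underlying graph on $N$ nodes is undirected and connected, with Laplacian $L$ having eigenvalues $0=\lambda_1<\lambda_2\le\cdots\le\lambda_N$. For $K\in\mathbb{R}^{m\times n}$ let $$J(K)=\int_0^\infty x^\top\left(L\otimes Q+L^2\otimes K^\top R K\right)x\,dt$$ be the cost along the solution of the controlled network $\dot{x}=(I_N\otimes A+L\otimes BK)x$, $x(0)=x_0$. Let $\gamma>0$. Choose $c$ such that $$\frac{2}{\lambda_2+\lambda_N}\le c<\frac{2}{\lambda_N}.$$ Then there exists a positive semi-definite matrix $P$ satisfying the Riccati inequality $$A^\top P+PA+(c^2\lambda_N^2-2c\lambda_N)PBR^{-1}B^\top P+\lambda_N Q<0.$$ Assume, moreover, that a positive semi-definite $P$ satisfying this inequality can be found such that $$x_0^\top\left(\left(I_N-\frac1N\mathbf{1}_N\mathbf{1}_N^\top\right)\otimes P\right)x_0<\gamma.$$ Let $K:=-cR^{-1}B^\top P$. Then the controlled network $\dot{x}=(I_N\otimes A+L\otimes BK)x$ reaches consensus and the control law $u=(L\otimes K)x$ is suboptimal, i.e., $J(K)<\gamma$.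
   Context: Setting: there are $N\ge 2$ identical agents $\dot{x}_i=Ax_i+Bu_i$, $x_i(0)=x_{i0}$, $i=1,\dots,N$, with $x_i\in\mathbb{R}^n$, $u_i\in\mathbb{R}^m$; $x=(x_1^\top,\dots,x_N^\top)^\top\in\mathbb{R}^{nN}$, $u=(u_1^\top,\dots,u_N^\top)^\top\in\mathbb{R}^{mN}$, and $x_0=(x_{10}^\top,\dots,x_{N0}^\top)^\top$ is given. A distributed control law is $u=(L\otimes K)x$ with a common gain $K\in\mathbb{R}^{m\times n}$; interconnecting it with the agents gives the controlled network $\dot{x}=(I_N\otimes A+L\otimes BK)x$. The pair $(A,B)$ is stabilizable if there is a real $F$ with $A+BF$ Hurwitz (all eigenvalues have negative real part). Consensus: the controlled network reaches consensus if for all $i,j=1,\dots,N$ and for all initial conditions on $x_i$ and $x_j$ one has $x_i(t)-x_j(t)\to 0$ as $t\to\infty$. Notation: for a real symmetric matrix $P$, $P>0$ ($P\ge 0$) means positive definite (positive semi-definite), $P<0$ means $-P>0$; positive semi-definite matrices are real symmetric. $I_k$ is the $k\times k$ identity, $\mathbf{1}_N\in\mathbb{R}^N$ is the all-ones vector, $\otimes$ is the Kronecker product. The graph Laplacian is $L=D-\mathcal{A}$ with $\mathcal{A}$ the (0/1) adjacency matrix and $D$ the diagonal degree matrix. *)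

(* Defs.v *)
From HB Require Import structures.
From mathcomp Require Import all_boot all_order all_algebra.
From mathcomp Require Import all_classical all_reals all_analysis.
From mathcomp Require Export mxtens complex.
Set Implicit Arguments.
Unset Strict Implicit.
Unset Printing Implicit Defensive.
Import Order.TTheory GRing.Theory Num.Theory numFieldNormedType.Exports.
Local Open Scope classical_set_scope.
Local Open Scope ring_scope.

Section Matrices.
Variable R : realType.

Definition qform n (M : 'M[R]_n) (v : 'cV[R]_n) : R := (v^T *m M *m v) 0 0.

Definition possemidef n (M : 'M[R]_n) : Prop :=
  M^T = M /\ forall v : 'cV[R]_n, 0 <= qform M v.

Definition posdef n (M : 'M[R]_n) : Prop :=
  M^T = M /\ forall v : 'cV[R]_n, v != 0 -> 0 < qform M v.

Definition negdef n (M : 'M[R]_n) : Prop := posdef (- M).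

Definition hurwitz n (M : 'M[R]_n) : Prop :=
  forall z : R[i], eigenvalue (map_mx (real_complex R) M) z -> complex.Re z < 0.

Definition stabilizable n m (A : 'M[R]_n) (B : 'M[R]_(n, m)) : Prop :=
  exists F : 'M[R]_(m, n), hurwitz (A + B *m F).

(* The eigenvalues in increasing order, repeated according to multiplicity. *)
Definition ordered_spectrum n (M : 'M[R]_n) (lam : n.-tuple R) : Prop :=
  sorted <=%R lam /\ char_poly M = \prod_(a <- lam) ('X - a%:P).

End Matrices.

Definition undirected_graph N (e : rel 'I_N) : Prop :=
  symmetric e /\ irreflexive e.

Definition connected_graph N (e : rel 'I_N) : Prop :=
  forall i j : 'I_N, connect e i j.

Definition adjacency (R : realType) N (e : rel 'I_N) : 'M[R]_N :=
  \matrix_(i, j) (e i j)%:R.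

Definition degree_mx (R : realType) N (e : rel 'I_N) : 'M[R]_N :=
  diag_mx (\row_i #|[set j | e i j]%SET|%:R).

Definition laplacian (R : realType) N (e : rel 'I_N) : 'M[R]_N :=
  degree_mx R e - adjacency R e.

Section Network.
Variables (R : realType) (N n m : nat).

Definition network_mx (L : 'M[R]_N) (A : 'M[R]_n) (B : 'M[R]_(n, m))
    (K : 'M[R]_(m, n)) : 'M[R]_(N * n) :=
  1%:M *t A + L *t (B *m K).

(* A trajectory is a total function of which only the values on [0, +oo[ are
   constrained: at time 0 it is only required to be continuous from the right. *)
Definition linear_trajectory d (M : 'M[R]_d) (x : R -> 'cV[R]_d) : Prop :=
  {within `[0, +oo[, continuous x} /\
  forall t : R, 0 < t -> is_derive t 1 x (M *m x t).

Definition agent (x : 'cV[R]_(N * n)) (i : 'I_N) : 'cV[R]_n :=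
  \col_k x (mxtens_index (i, k)) 0.

(* The initial state is unconstrained: all initial conditions are covered. *)
Definition reaches_consensus (M : 'M[R]_(N * n)) : Prop :=
  forall x : R -> 'cV[R]_(N * n), linear_trajectory M x ->
  forall i j : 'I_N,
    agent (x t) i - agent (x t) j @[t --> +oo] --> (0 : 'cV[R]_n).

(* Valued in the extended reals: +oo when the integral diverges. *)
Definition cost (L : 'M[R]_N) (Q : 'M[R]_n) (W : 'M[R]_m) (K : 'M[R]_(m, n))
    (x : R -> 'cV[R]_(N * n)) : \bar R :=
  \int[lebesgue_measure]_(t in `[0, +oo[)
    (qform (L *t Q + (L *m L) *t (K^T *m W *m K)) (x t))%:E.

(* The cost bound for the solution starting at x0 (unique, since the
   network is linear). *)
Definition suboptimal (L : 'M[R]_N) (A : 'M[R]_n) (B : 'M[R]_(n, m))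
    (Q : 'M[R]_n) (W : 'M[R]_m) (x0 : 'cV[R]_(N * n)) (gamma : R)
    (K : 'M[R]_(m, n)) : Prop :=
  forall x : R -> 'cV[R]_(N * n),
    linear_trajectory (network_mx L A B K) x -> x 0 = x0 ->
    (cost L Q W K x < gamma%:E)%E.

Definition riccati_lhs (A : 'M[R]_n) (B : 'M[R]_(n, m)) (Q : 'M[R]_n)
    (W : 'M[R]_m) (c lamN : R) (P : 'M[R]_n) : 'M[R]_n :=
  A^T *m P + P *m A
  + (c ^+ 2 * lamN ^+ 2 - 2 * c * lamN) *: (P *m B *m invmx W *m B^T *m P)
  + lamN *: Q.

(* The orthogonal projection I - (1/N) 1 1^T onto the complement of the
   all-ones vector. *)
Definition centering_mx : 'M[R]_N :=
  1%:M - N%:R^-1 *: (const_mx 1 *m (const_mx 1 : 'cV[R]_N)^T).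

End Network.

(* Main.v *)
Require Import Defs.
From mathcomp Require Import all_boot all_order all_algebra.
From mathcomp Require Import all_classical all_reals all_analysis.
From mathcomp Require Import spectral sesquilinear measurable_realfun.
From mathcomp Require Import ring lra.
Import Order.TTheory GRing.Theory Num.Theory numFieldNormedType.Exports.
Local Open Scope ring_scope.
Set Implicit Arguments.
Unset Strict Implicit.
Unset Printing Implicit Defensive.

(** Existence of [P].  A Hurwitz matrix has a Lyapunov matrix
    ([hurwitz_lyapunov]).  Applied to a stabilized closed loop [A + B *m F] it
    gives [X], and [P = s^-1 *: X] with [s] small solves the Riccati inequality
    ([riccati_inequality_solvable]).  The coefficient of the quadratic term is
    negative because the bounds on [c] force [0 < c * lam`_N.-1 < 2]
    ([coupling_gain_bounds]).

    Consensus and cost. Write [Pi] for [centering_mx R N]. The single Lyapunov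
    function [V x = qform (Pi *t P) x] serves all modes at once. For [mu]
    between [lam`_1] and [lam`_N.-1], the number [c ^+ 2 * mu ^+ 2 - 2 * c * mu]
    is largest at [mu = lam`_N.-1], by the lower bound on [c]. So [L] and [c ^+
    2 *: (L *m L) - (2 * c) *: L] are bounded above, in the semidefinite order,
    by the multiples of [Pi] obtained by putting [lam`_N.-1] for [L]
    ([laplacian_quadratic_possemidef]; connectedness enters here, by making the
    kernel of [L] the line killed by [Pi]). Taking Kronecker products with [Q]
    and [P *m B *m invmx W *m B^T *m P], the derivative of [V] along the network
    plus the running cost is at most [qform (Pi *t S) x], with [S] the left-hand
    side of the Riccati inequality ([network_dissipation]).

    As [S] is negative definite, this is at most [- alpha * V x] for some
    [alpha > 0], so [V] tends to [0] along trajectories ([dissipation_cvg0]).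
    The Riccati inequality also makes [P] definite ([riccati_posdef]), so the
    deviations of the agents from their average tend to [0]: this is consensus.
    Integrating the same inequality over the half-line bounds the cost by
    [V (x 0) < gamma] ([dissipation_integral_le]).

    All facts on quadratic forms come from a real version of the spectral
    theorem, [symmetric_eigenframe]. *)

(** * Complex matrices through their real and imaginary parts *)

Lemma Re_sum (R : rcfType) I (r : seq I) (P : pred I) (F : I -> R[i]) :
  complex.Re (\sum_(i <- r | P i) F i) = \sum_(i <- r | P i) complex.Re (F i).
Proof. by apply: big_morph => // -[a b] [c d]. Qed.

Lemma Im_sum (R : rcfType) I (r : seq I) (P : pred I) (F : I -> R[i]) :
  complex.Im (\sum_(i <- r | P i) F i) = \sum_(i <- r | P i) complex.Im (F i).
Proof. by apply: big_morph => // -[a b] [c d]. Qed.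

(** Stacking the real and imaginary parts of the rows of a complex matrix turns
    a complex coordinate change into a real one, at the price of doubling the
    number of rows; this transfers triangularization and diagonalization
    results over [R[i]] to real matrices. *)
Definition realify (R : rcfType) m n (U : 'M[R[i]]_(m, n)) : 'M[R]_(m + m, n) :=
  col_mx (map_mx (@complex.Re R) U) (map_mx (@complex.Im R) U).

Lemma realify_mul_real (R : rcfType) m n p (U : 'M[R[i]]_(m, n))
    (M : 'M[R]_(n, p)) :
  realify (U *m map_mx (real_complex R) M) = realify U *m M.
Proof.
rewrite /realify mul_col_mx; congr col_mx; apply/matrixP => i j; rewrite !mxE.
  rewrite Re_sum; apply: eq_bigr => k _; rewrite !mxE.
  by case: (U i k) => a b /=; rewrite mulr0 subr0.
rewrite Im_sum; apply: eq_bigr => k _; rewrite !mxE.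
by case: (U i k) => a b /=; rewrite mulr0 add0r.
Qed.

Lemma realify_diag_mul (R : rcfType) m n (d : 'rV[R]_m) (U : 'M[R[i]]_(m, n)) :
  realify (diag_mx (map_mx (real_complex R) d) *m U)
  = diag_mx (row_mx d d) *m realify U.
Proof.
rewrite /realify !mul_diag_mx; apply/matrixP => i j.
rewrite !mxE; case: splitP => k ik; rewrite !mxE.
  by case: (U k j) => a b /=; rewrite mul0r subr0.
by case: (U k j) => a b /=; rewrite mul0r addr0.
Qed.

Lemma realify_bilinear (R : rcfType) m n p (U : 'M[R[i]]_(m, n))
    (V : 'M[R[i]]_(m, p)) i j :
  ((realify U)^T *m realify V) i j
  = complex.Re (((map_mx Num.conj U)^T *m V) i j).
Proof.
rewrite /realify tr_col_mx mul_row_col !mxE Re_sum -big_split.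
apply: eq_bigr => k _; rewrite !mxE.
by case: (U k i) => a b; case: (V k j) => a' b' /=; ring.
Qed.

(** The spectral theorem for a real symmetric matrix, with the orthonormal basis
    replaced by a tight frame: the rows of [Z] that do not vanish are
    eigenvectors, and [Z] is an isometry.  This is weaker than an orthogonal
    diagonalization, but suffices to write every quadratic form in [M] as a
    weighted sum of squares.  It is the complex spectral theorem read through
    [realify]. *)
Lemma symmetric_eigenframe (R : rcfType) n (M : 'M[R]_n) : M^T = M ->
  exists p (Z : 'M[R]_(p, n)) (d : 'rV[R]_p),
    Z^T *m Z = 1%:M /\ Z *m M = diag_mx d *m Z.
Proof.
move=> Msym; pose MC := map_mx (real_complex R) M.
have MCreal : MC \is a mxOver Num.real.
  by apply/mxOverP => i j; rewrite mxE; apply/complex_realP; exists (M i j).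
have MCherm : MC \is hermitianmx _ false Num.conj.
  apply: realsym_hermsym => //; apply/is_hermitianmxP.
  by rewrite expr0 scale1r map_mx_id// /MC map_trmx Msym.
have dreal := hermitian_spectral_diag_real MCherm.
have /hermitian_normalmx/orthomx_spectralP := MCherm.
set U := spectralmx MC in dreal *; set D := spectral_diag MC in dreal * => MCE.
have Uunit : U \is unitarymx by exact: spectral_unitarymx.
pose d := map_mx (@complex.Re R) D.
have DE : D = map_mx (real_complex R) d.
  apply/matrixP => i j; rewrite !mxE; apply/esym/RRe_real.
  exact: (mxOverP dreal).
exists (n + n)%N, (realify U), (row_mx d d); split.
  apply/matrixP => i j; rewrite realify_bilinear map_trmx -invmx_unitary//.
  by rewrite mulVmx ?unitarymx_unit// !mxE; case: eqP.
rewrite -realify_mul_real -realify_diag_mul -DE -/MC {1}MCE.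
by rewrite !mulmxA mulmxV ?unitarymx_unit// mul1mx.
Qed.

(** * Quadratic forms *)

(** The reciprocal of [1 + \sum_i 1 / f i] serves as a lower bound, which avoids
    minima and so also covers the partially ordered field [R[i]]. *)
Lemma finite_pos_lower_bound (F : numFieldType) (I : finType) (f : I -> F) :
  (forall i, 0 < f i) -> exists2 delta : F, 0 < delta & forall i, delta <= f i.
Proof.
move=> f_gt0; pose s := 1 + \sum_i (f i)^-1.
have sum_ge0 (P : pred I) : 0 <= \sum_(i | P i) (f i)^-1.
  by apply: sumr_ge0 => i _; rewrite invr_ge0 ltW.
have s_gt0 : 0 < s by rewrite ltr_wpDr.
exists s^-1; rewrite ?invr_gt0// => i.
rewrite -[leRHS]invrK lef_pV2 ?posrE ?invr_gt0//.
by rewrite /s (bigD1 i)//= addrCA lerDl addr_ge0.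
Qed.

Definition normsq (R : realType) n (v : 'cV[R]_n) : R := qform 1%:M v.

Lemma normsqE (R : realType) n (v : 'cV[R]_n) : normsq v = \sum_i v i 0 ^+ 2.
Proof.
by rewrite /normsq /qform mulmx1 mxE; apply: eq_bigr => i _; rewrite !mxE expr2.
Qed.

Lemma normsq_ge0 (R : realType) n (v : 'cV[R]_n) : 0 <= normsq v.
Proof. by rewrite normsqE; apply: sumr_ge0 => i _; exact: sqr_ge0. Qed.

Lemma normsq_eq0 (R : realType) n (v : 'cV[R]_n) : normsq v = 0 -> v = 0.
Proof.
rewrite normsqE => /eqP; rewrite psumr_eq0 => [/allP v0|i _]; last exact: sqr_ge0.
apply/colP => i; rewrite [RHS]mxE; apply/eqP; rewrite -sqrf_eq0.
exact: v0 (mem_index_enum i).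
Qed.

Lemma normsq_gt0 (R : realType) n (v : 'cV[R]_n) : v != 0 -> 0 < normsq v.
Proof.
move=> v0; rewrite lt_def normsq_ge0 andbT.
by apply: contra_neq v0; exact: normsq_eq0.
Qed.

Lemma sqr_coord_le_normsq (R : realType) n (v : 'cV[R]_n) i :
  v i 0 ^+ 2 <= normsq v.
Proof.
rewrite normsqE (bigD1 i)//= lerDl.
by apply: sumr_ge0 => j _; exact: sqr_ge0.
Qed.

Lemma qformD (R : realType) n (M N : 'M[R]_n) v :
  qform (M + N) v = qform M v + qform N v.
Proof. by rewrite /qform mulmxDr mulmxDl mxE. Qed.

Lemma qformZ (R : realType) n a (M : 'M[R]_n) v : qform (a *: M) v = a * qform M v.
Proof. by rewrite /qform -scalemxAr -scalemxAl mxE. Qed.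

Lemma qformN (R : realType) n (M : 'M[R]_n) v : qform (- M) v = - qform M v.
Proof. by rewrite -scaleN1r qformZ mulN1r. Qed.

Lemma qform0 (R : realType) n (M : 'M[R]_n) : qform M 0 = 0.
Proof. by rewrite /qform mulmx0 mxE. Qed.

Lemma qform_congr (R : realType) n p (F : 'M[R]_(p, n)) (M : 'M[R]_p) v :
  qform (F^T *m M *m F) v = qform M (F *m v).
Proof. by rewrite /qform trmx_mul !mulmxA. Qed.

Lemma qform_gram (R : realType) n p (F : 'M[R]_(p, n)) v :
  qform (F^T *m F) v = normsq (F *m v).
Proof. by rewrite -{1}[F^T]mulmx1 qform_congr. Qed.

Lemma qform_tr (R : realType) n (M : 'M[R]_n) v : qform M^T v = qform M v.
Proof.
by rewrite /qform -[in RHS](trmxK (_ *m _ *m _)) [RHS]mxE !trmx_mul trmxK mulmxA.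
Qed.

Lemma qform_diag (R : realType) n (d : 'rV[R]_n) v :
  qform (diag_mx d) v = \sum_i d 0 i * v i 0 ^+ 2.
Proof.
rewrite /qform -mulmxA mul_diag_mx mxE; apply: eq_bigr => i _.
by rewrite !mxE; ring.
Qed.

Lemma posdef_possemidef (R : realType) n (M : 'M[R]_n) : posdef M -> possemidef M.
Proof.
case=> Msym M_gt0; split=> // v; have [->|v0] := eqVneq v 0; first by rewrite qform0.
exact/ltW/M_gt0.
Qed.

Section Eigenframe.
Variables (R : realType) (n p : nat) (M : 'M[R]_n) (Z : 'M[R]_(p, n)).
Variable d : 'rV[R]_p.
Hypotheses (Msym : M^T = M) (ZZ : Z^T *m Z = 1%:M) (ZM : Z *m M = diag_mx d *m Z).

Lemma eigenframe_normsq v : normsq v = normsq (Z *m v).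
Proof. by rewrite -qform_gram ZZ. Qed.

Lemma eigenframe_mul (v : 'cV[R]_n) i : (Z *m (M *m v)) i 0 = d 0 i * (Z *m v) i 0.
Proof. by rewrite mulmxA ZM -mulmxA mul_diag_mx mxE. Qed.

Lemma eigenframe_decomp : M = Z^T *m diag_mx d *m Z.
Proof. by rewrite -mulmxA -ZM mulmxA ZZ mul1mx. Qed.

Lemma eigenframe_qform v : qform M v = \sum_i d 0 i * (Z *m v) i 0 ^+ 2.
Proof. by rewrite {1}eigenframe_decomp qform_congr qform_diag. Qed.

Lemma eigenframe_eigenvector i : M *m (row i Z)^T = d 0 i *: (row i Z)^T.
Proof.
rewrite -{1}Msym -trmx_mul -row_mul ZM; apply/colP => j.
by rewrite mul_diag_mx !mxE.
Qed.

Lemma eigenframe_qform_row i :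
  qform M (row i Z)^T = d 0 i * normsq (row i Z)^T.
Proof.
by rewrite /normsq /qform -mulmxA eigenframe_eigenvector -scalemxAr mxE mulmx1.
Qed.

Lemma eigenframe_row0 i (v : 'cV[R]_n) : row i Z = 0 -> (Z *m v) i 0 = 0.
Proof.
move=> Zi; have -> : (Z *m v) i 0 = row i (Z *m v) 0 0 by rewrite [RHS]mxE.
by rewrite row_mul Zi mul0mx mxE.
Qed.

End Eigenframe.

Lemma posdef_ge_normsq (R : realType) n (M : 'M[R]_n) : posdef M ->
  exists2 beta : R, 0 < beta & forall v, beta * normsq v <= qform M v.
Proof.
case=> Msym M_gt0; have [p [Z [d [ZZ ZM]]]] := symmetric_eigenframe Msym.
(* The weight of a vanishing row of the frame is arbitrary, hence the default
   value [1]: such a row contributes nothing to either side. *)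
have [|beta beta_gt0 betaP] :=
    @finite_pos_lower_bound R 'I_p (fun i => if row i Z == 0 then 1 else d 0 i).
  move=> i; case: ifPn => // Zi.
  have Zi' : (row i Z)^T != 0 by rewrite -trmx0 (inj_eq trmx_inj).
  by have := M_gt0 _ Zi'; rewrite (eigenframe_qform_row Msym ZM) pmulr_lgt0// normsq_gt0.
exists beta => // v.
rewrite (eigenframe_qform ZZ ZM) (eigenframe_normsq ZZ) normsqE mulr_sumr.
apply: ler_sum => i _; have := betaP i; case: ifPn => [/eqP Zi _|_ le_beta].
  by rewrite (eigenframe_row0 _ Zi) expr0n/= !mulr0.
by rewrite ler_wpM2r// sqr_ge0.
Qed.

Lemma symmetric_le_normsq (R : realType) n (M : 'M[R]_n) : M^T = M ->
  exists2 kappa : R, 0 < kappa & forall v, qform M v <= kappa * normsq v.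
Proof.
move=> Msym; have [p [Z [d [ZZ ZM]]]] := symmetric_eigenframe Msym.
exists (1 + \sum_i `|d 0 i|); first by rewrite ltr_wpDr// sumr_ge0.
move=> v; rewrite (eigenframe_qform ZZ ZM) (eigenframe_normsq ZZ) normsqE mulr_sumr.
apply: ler_sum => i _; rewrite ler_wpM2r ?sqr_ge0// (le_trans (ler_norm _))//.
by rewrite (bigD1 i)//= addrCA lerDl addr_ge0// sumr_ge0.
Qed.

Lemma possemidef_gram (R : realType) n (M : 'M[R]_n) : possemidef M ->
  exists p (F : 'M[R]_(p, n)), M = F^T *m F.
Proof.
case=> Msym M_ge0; have [p [Z [d [ZZ ZM]]]] := symmetric_eigenframe Msym.
exists p, (diag_mx (map_mx Num.sqrt d) *m Z).
rewrite trmx_mul tr_diag_mx [LHS](eigenframe_decomp ZZ ZM) -!mulmxA; congr mulmx.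
rewrite !mul_diag_mx; apply/matrixP => i j; rewrite !mxE mulrA -expr2.
have [Zi|Zi] := eqVneq (row i Z) 0.
  by have /rowP/(_ j) := Zi; rewrite !mxE => ->; rewrite !mulr0.
have Zi' : (row i Z)^T != 0 by rewrite -trmx0 (inj_eq trmx_inj).
rewrite sqr_sqrtr//; have := M_ge0 (row i Z)^T.
by rewrite (eigenframe_qform_row Msym ZM) pmulr_lge0// normsq_gt0.
Qed.

Lemma possemidef_qform0 (R : realType) n (M : 'M[R]_n) v :
  possemidef M -> qform M v = 0 -> M *m v = 0.
Proof.
move=> /possemidef_gram[p [F ->]]; rewrite qform_gram => /normsq_eq0 Fv0.
by rewrite -mulmxA Fv0 mulmx0.
Qed.

Lemma posdef_unitmx (R : realType) n (M : 'M[R]_n) : posdef M -> M \in unitmx.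
Proof.
case=> Msym M_gt0; rewrite -row_free_unit -kermx_eq0; apply/eqP/row_matrixP => i.
rewrite row0; set u := row i _; have uM : u *m M = 0.
  by rewrite -row_mul mulmx_ker row0.
apply/eqP/negPn/negP => u0.
have /M_gt0 : u^T != 0 by rewrite -trmx0 (inj_eq trmx_inj).
by rewrite /qform trmxK uM mul0mx mxE ltxx.
Qed.

(** * Lyapunov inequality for Hurwitz matrices *)

(** After Schur triangularization, conjugating by [diag (omega ^ i)] multiplies
    the strictly lower triangular entries by positive powers of [omega]: for
    small [omega] the Hermitian part of the result is dominated by its
    diagonal, the real parts of the eigenvalues. *)
Lemma stable_dissipative_coordinates (C : numClosedFieldType) n (A : 'M[C]_n) :
  (forall z, eigenvalue A z -> 'Re z < 0) ->
  exists S T : 'M[C]_n, [/\ S \in unitmx, S *m A = T *m S &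
    forall y : 'cV[C]_n, y != 0 ->
      'Re (((map_mx Num.conj y)^T *m (T *m y)) 0 0) < 0].
Proof.
case: n A => [|n] A stabA.
  exists 1%:M, A; split; rewrite ?unitmx1 ?mul1mx ?mulmx1// => y.
  by rewrite [y]flatmx0 eqxx.
have [//|P Punitary] := @Schur C n.+1 A _.
have Punit := unitarymx_unit Punitary.
set T0 := conjmx P A => T0is_trig.
have T0trig (i j : 'I_n.+1) : (i < j)%N -> T0 i j = 0 by exact/is_trig_mxP.
have T0P : T0 *m P = P *m A by rewrite /T0 conjumx// mulmxKV.
have diag_stab i : 'Re (T0 i i) < 0.
  apply: stabA; have : T0 i i \in eigenvalue T0.
    rewrite -[_ \in _]/(eigenvalue _ _) eigenvalue_root_char char_poly_trig//.
    by rewrite rootE horner_prod (bigD1 i)//= hornerXsubC subrr mul0r.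
  apply: eigenvalue_conjmx; last by rewrite row_free_unit.
  exact: stablemx_unit.
clearbody T0.
have [|delta delta_gt0 deltaP] :=
  @finite_pos_lower_bound C 'I_n.+1 (fun i => - 'Re (T0 i i)).
  by move=> i; rewrite oppr_gt0.
pose tau : C := \sum_i \sum_j `|T0 i j|.
have tauP i j : `|T0 i j| <= tau.
  rewrite /tau (bigD1 i)//= (bigD1 j)//= -addrA lerDl addr_ge0//.
    by apply: sumr_ge0.
  by apply: sumr_ge0 => k _; apply: sumr_ge0.
have tau_ge0 : 0 <= tau by apply: le_trans (tauP 0 0).
pose s := delta + tau *+ n.+1.
have s_gt0 : 0 < s by rewrite ltr_wpDr// mulrn_wge0.
pose omega := delta / s.
have omega_gt0 : 0 < omega by rewrite divr_gt0.
have omega_le1 : omega <= 1 by rewrite ler_pdivrMr// mul1r lerDl mulrn_wge0.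
have omega_small : omega * tau *+ n.+1 < delta.
  rewrite -mulrnAr /omega mulrAC ltr_pdivrMr// ltr_pM2l//.
  by rewrite /s ltrDr.
have omega0 : omega != 0 by rewrite gt_eqF.
pose D := diag_mx (\row_(i < n.+1) omega ^+ i).
pose T := \matrix_(i, j) (omega ^+ i * T0 i j / omega ^+ j).
have Tdiag i : T i i = T0 i i by rewrite mxE mulrAC mulfV ?mul1r// expf_neq0.
have Toff (i j : 'I_n.+1) : i != j -> `|T i j| <= omega * tau.
  rewrite mxE neq_ltn => /orP[ij|ji].
    by rewrite T0trig// mulr0 mul0r normr0 mulr_ge0// ltW.
  rewrite mulrAC -expfB// normrM (ger0_norm (exprn_ge0 _ (ltW omega_gt0))).
  apply: ler_pM; rewrite ?exprn_ge0 ?normr_ge0 ?tauP ?(ltW omega_gt0)//.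
  have /prednK <- : (0 < i - j)%N by rewrite subn_gt0.
  rewrite exprS ler_piMr//; first exact: ltW.
  by rewrite exprn_ile1// ltW.
exists (D *m P), T; split.
- rewrite unitmx_mul Punit andbT unitmxE det_diag unitfE; apply/prodf_neq0 => i _.
  by rewrite mxE; exact: expf_neq0.
- rewrite -mulmxA -T0P !mulmxA; congr (_ *m P).
  apply/matrixP => i j; rewrite /D mul_diag_mx mul_mx_diag !mxE.
  by rewrite divfK ?expf_neq0.
move=> y y0; pose N := \sum_i `|y i 0| ^+ 2.
have N_gt0 : 0 < N.
  rewrite lt_def sumr_ge0 ?andbT => [|i _]; last by rewrite exprn_ge0.
  apply: contra_neq y0 => /eqP; rewrite psumr_eq0 => [/allP N0|i _].
    apply/colP => i; apply/eqP; rewrite [X in _ == X]mxE -normr_eq0 -sqrf_eq0.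
    exact: N0 (mem_index_enum i).
  by rewrite exprn_ge0.
have termP i j : 'Re ((y i 0)^* * (T i j * y j 0)) <=
    - (delta * `|y i 0| ^+ 2) *+ (i == j)
    + omega * tau / 2 * (`|y i 0| ^+ 2 + `|y j 0| ^+ 2).
  have [<-|ij] := eqVneq i j.
    rewrite Tdiag mulrCA -normCKC mulr1n ReMr ?ger0_real ?exprn_ge0//.
    rewrite -mulNr ler_wpDr ?ler_wpM2r ?exprn_ge0// 1?lerNr//.
    by rewrite !mulr_ge0 ?addr_ge0 ?exprn_ge0 ?invr_ge0// ltW.
  rewrite mulr0n add0r; apply: le_trans (leif_Re_Creal _) _.
  rewrite !normrM norm_conjC mulrCA -mulrA.
  apply: ler_pM; rewrite ?mulr_ge0 ?Toff//.
  rewrite [leRHS]mulrC.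
  by apply: (real_leif_mean_square _ _); exact: ger0_real.
have -> : ((map_mx Num.conj y)^T *m (T *m y)) 0 0
    = \sum_i \sum_j (y i 0)^* * (T i j * y j 0).
  rewrite mxE; apply: eq_bigr => i _; rewrite !mxE mulr_sumr.
  by apply: eq_bigr.
have -> : 'Re (\sum_i \sum_j (y i 0)^* * (T i j * y j 0))
    = \sum_i \sum_j 'Re ((y i 0)^* * (T i j * y j 0)).
  by rewrite raddf_sum; apply: eq_bigr => i _; rewrite raddf_sum.
apply: le_lt_trans (_ : (omega * tau *+ n.+1 - delta) * N < 0); last first.
  by rewrite pmulr_llt0// subr_lt0.
apply: le_trans (ler_sum _ (fun i _ => ler_sum _ (fun j _ => termP i j))) _.
under eq_bigr => i _.
  rewrite big_split/= (bigD1 i)//= eqxx mulr1n big1 ?addr0 => [|j]; last first.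
    by rewrite eq_sym => /negPf ->.
  rewrite -mulr_sumr big_split/= sumr_const card_ord.
  over.
rewrite big_split/= sumrN -mulr_sumr -/N -mulr_sumr big_split/= sumr_const card_ord.
rewrite sumrMnl -/N le_eqVlt; apply/orP; left; apply/eqP.
rewrite -[N *+ n.+1 + _]mulr2n -(mulr_natl (N *+ n.+1)).
rewrite -(mulrA (omega * tau)) mulKf ?pnatr_eq0//.
by rewrite mulrBl mulrnAl mulrnAr addrC.
Qed.

(** In the coordinates [Z] obtained from the dissipative complex ones, the squared
    length is a strict Lyapunov function of [M]; pulled back, it is
    [Z^T *m Z]. *)
Lemma hurwitz_lyapunov (R : realType) n (M : 'M[R]_n) : hurwitz M ->
  exists X : 'M[R]_n, posdef X /\ negdef (M^T *m X + X *m M).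
Proof.
move=> stabM; pose MC := map_mx (real_complex R) M.
have [|S [T [Sunit SM Tdiss]]] := @stable_dissipative_coordinates _ _ MC.
  by move=> z /stabM; rewrite -complexRe -(ltcR (complex.Re z) 0).
pose Z := realify S; pose X := Z^T *m Z.
have Xsym : X^T = X by rewrite /X trmx_mul trmxK.
pose y (v : 'cV[R]_n) := S *m map_mx (real_complex R) v.
have Zv (v : 'cV[R]_n) : Z *m v = realify (y v) by rewrite realify_mul_real.
have y0 (v : 'cV[R]_n) : v != 0 -> y v != 0.
  apply: contra_neq => /(congr1 (mulmx (invmx S))).
  rewrite mulmx0 mulKmx// => /matrixP v0; apply/matrixP => i j.
  by have := v0 i j; rewrite !mxE => -[].
exists X; split.
  split=> // v v0; rewrite /X qform_gram normsq_gt0//.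
  apply: contra_neq (y0 _ v0) => Zv0; apply/matrixP => i j.
  have /matrixP rv0 : realify (y v) = 0 by rewrite -Zv.
  have := rv0 (lshift n i) j; have := rv0 (rshift n i) j.
  rewrite /realify col_mxEd [LHS]mxE [RHS]mxE => Im0.
  rewrite col_mxEu [LHS]mxE [RHS]mxE => Re0; rewrite [RHS]mxE.
  by move: Re0 Im0; case: (y v i j) => a b /= -> ->.
split.
  rewrite linearN/= linearD/= (trmx_mul M^T) (trmx_mul X M).
  by rewrite trmxK Xsym addrC.
move=> v v0; rewrite qformN oppr_gt0.
have -> : qform (M^T *m X + X *m M) v = qform (X *m M) v *+ 2.
  by rewrite qformD -(qform_tr (M^T *m X)) trmx_mul trmxK Xsym.
rewrite pmulrn_llt0//.
have -> : qform (X *m M) v = ((Z *m v)^T *m (Z *m (M *m v))) 0 0.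
  by rewrite /qform trmx_mul !mulmxA.
have -> : Z *m (M *m v) = realify (T *m y v).
  by rewrite mulmxA -realify_mul_real SM -realify_mul_real -mulmxA.
rewrite Zv realify_bilinear.
by have := Tdiss _ (y0 _ v0); rewrite -complexRe (ltcR _ 0).
Qed.

(** * Solvability of the Riccati inequality *)

Lemma qform_comb (R : realType) n (W : 'M[R]_n) a u w : W^T = W ->
  qform W (a *: u + w) =
  a ^+ 2 * qform W u + 2 * a * (u^T *m W *m w) 0 0 + qform W w.
Proof.
move=> Wsym; have swap : (w^T *m W *m u) 0 0 = (u^T *m W *m w) 0 0.
  by rewrite -[in RHS](trmxK (u^T *m _ *m _)) [RHS]mxE !trmx_mul trmxK Wsym mulmxA.
have trE : (a *: u + w)^T = a *: u^T + w^T by rewrite linearD linearZ.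
rewrite /qform trE !mulmxDl !mulmxDr -!scalemxAl -!scalemxAr.
move: swap; move: (w^T *m W *m u) (u^T *m W *m w) (u^T *m W *m u) (w^T *m W *m w).
by move=> wu uw uu ww swap; rewrite !mxE swap; ring.
Qed.

(** Let [X] be a Lyapunov matrix for a stabilized closed loop [A + B *m F] and
    [P = s^-1 *: X].  The cross term [X *m B *m F] left over from the feedback is
    absorbed, by completing a square weighted by [W], into the quadratic term
    of the Riccati expression, which is of order [s^-2]; the remainder is
    [F^T *m W *m F] and [Q] with weights of order one, beaten by the Lyapunov
    decrease, of order [s^-1]. *)
Lemma riccati_inequality_solvable (R : realType) n m (A : 'M[R]_n)
    (B : 'M[R]_(n, m)) (Q : 'M[R]_n) (W : 'M[R]_m) (c lamN : R) :
  stabilizable A B -> Q^T = Q -> posdef W -> 0 < 2 * c * lamN - c ^+ 2 * lamN ^+ 2 ->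
  exists P : 'M[R]_n, possemidef P /\ negdef (riccati_lhs A B Q W c lamN P).
Proof.
move=> [F /hurwitz_lyapunov[X [Xpos Xdecr]]] Qsym Wpos.
set mu := 2 * c * lamN - _ => mu_gt0.
have [Xsym _] := Xpos; have [Wsym _] := Wpos; have Wunit := posdef_unitmx Wpos.
have WIsym : (invmx W)^T = invmx W by rewrite trmx_inv Wsym.
have [beta beta_gt0 betaP] := posdef_ge_normsq Xdecr.
have FWFsym : (F^T *m W *m F)^T = F^T *m W *m F.
  by rewrite !trmx_mul trmxK Wsym mulmxA.
have [kF kF_gt0 kFP] := symmetric_le_normsq FWFsym.
have [kQ kQ_gt0 kQP] :
    exists2 k : R, 0 < k & forall v, qform (lamN *: Q) v <= k * normsq v.
  by apply: symmetric_le_normsq; rewrite linearZ/= Qsym.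
pose s : R := beta / (2 * (kF / mu + kQ)).
have k_gt0 : 0 < kF / mu + kQ by rewrite addr_gt0 ?divr_gt0.
have s_gt0 : 0 < s by rewrite divr_gt0 ?mulr_gt0.
have s_small : s * (kF / mu + kQ) < beta.
  by rewrite /s invfM mulrA divfK ?gt_eqF// ltr_pdivrMr// ltr_pMr// ltr1n.
exists (s^-1 *: X); split.
  split=> [|v]; first by rewrite linearZ/= Xsym.
  rewrite qformZ mulr_ge0 ?invr_ge0 ?(ltW s_gt0)//.
  by case: (posdef_possemidef Xpos) => _; apply.
have coefE : c ^+ 2 * lamN ^+ 2 - 2 * c * lamN = - mu by rewrite /mu opprB.
pose G := X *m B *m invmx W *m B^T *m X.
have lhsE : riccati_lhs A B Q W c lamN (s^-1 *: X) =
    s^-1 *: (A^T *m X + X *m A) - (mu * s^-1 ^+ 2) *: G + lamN *: Q.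
  rewrite /riccati_lhs coefE -!scalemxAr -!scalemxAl scalerDr -/G.
  by rewrite !scalerA -scaleNr; congr (_ + _ *: _ + _); ring.
split.
  have ATX : (A^T *m X + X *m A)^T = A^T *m X + X *m A.
    by rewrite linearD/= !trmx_mul trmxK Xsym addrC.
  have Gsym : G^T = G by rewrite /G !trmx_mul trmxK WIsym Xsym !mulmxA.
  rewrite {}lhsE; move: ATX Gsym; move: (A^T *m X + _) G => L G' Lsym Gsym.
  by apply/matrixP => i j; rewrite -{2}Lsym -{2}Gsym -{2}Qsym !mxE.
move=> v v0; rewrite qformN oppr_gt0 lhsE !(qformD, qformN, qformZ).
pose u := invmx W *m B^T *m X *m v.
set a := qform (A^T *m X) v + _.
pose b := qform (X *m B *m F) v.
have decr : beta * normsq v <= - (a + 2 * b).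
  apply: le_trans (betaP v) _; rewrite qformN lerN2.
  rewrite linearD/= mulmxDl mulmxDr !qformD trmx_mul.
  have -> : qform (F^T *m B^T *m X) v = b.
    by rewrite -qform_tr !trmx_mul !trmxK Xsym mulmxA.
  by rewrite mulmxA -/b /a; lra.
have square : 0 <= (mu / s) ^+ 2 * qform G v + 2 * (mu / s) * b
                   + qform (F^T *m W *m F) v.
  have [_ /(_ ((mu / s) *: u + F *m v))] := posdef_possemidef Wpos.
  have uW : u^T *m W = v^T *m X *m B.
    by rewrite /u !trmx_mul trmxK Xsym WIsym -!mulmxA mulVmx// mulmx1.
  have GE : qform G v = qform W u by rewrite /qform uW /u /G !mulmxA.
  have bE : b = (u^T *m W *m (F *m v)) 0 0 by rewrite uW /b /qform !mulmxA.
  by rewrite (qform_comb _ _ _ Wsym) GE bE qform_congr.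
have kFP' := kFP v; have kQP' := kQP v; rewrite qformZ in kQP'.
have nv0 := normsq_gt0 v0.
move: square decr kFP' kQP'.
move: (qform G v) (qform (F^T *m W *m F) v) (qform Q v) (normsq v) nv0.
move=> g f q N N_gt0 square decr f_le q_le.
have rho_gt0 : 0 < mu / s by rewrite divr_gt0.
have square' : 0 <= mu / s * g + 2 * b + f / (mu / s).
  rewrite -(pmulr_rge0 _ rho_gt0); apply: le_trans square _.
  rewrite le_eqVlt; apply/orP; left; apply/eqP; field.
  by rewrite !gt_eqF.
have f_le' : f / (mu / s) <= s * (kF / mu) * N.
  rewrite ler_pdivrMr// (le_trans f_le)// le_eqVlt; apply/orP; left; apply/eqP.
  by field; rewrite !gt_eqF.
have q_le' : s * (lamN * q) <= s * kQ * N by rewrite -mulrA ler_wpM2l// ltW.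
have gapN : s * (kF / mu + kQ) * N < beta * N by rewrite ltr_pM2r.
have -> : s^-1 * a - mu * s^-1 ^+ 2 * g + lamN * q
    = s^-1 * (a - mu / s * g + s * (lamN * q)).
  by field; rewrite gt_eqF.
rewrite pmulr_rlt0 ?invr_gt0//.
move: square' f_le' q_le' gapN decr; rewrite mulrDr mulrDl.
move: (mu / s * g) (f / _) (s * (lamN * q)) (s * kQ * N) (s * (kF / mu) * N).
move: (beta * N) => *; lra.
Qed.

(** * Laplacian and centering projection *)

Section Centering.
Variables (R : realType) (N : nat).
Hypothesis N_gt0 : (0 < N)%N.
Local Notation ones := (const_mx 1 : 'cV[R]_N).
Local Notation Pi := (centering_mx R N).

Lemma centering_tr : Pi^T = Pi.
Proof. by rewrite /centering_mx linearB/= linearZ/= trmx_mul trmxK trmx1. Qed.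

Lemma mul_centering (M : 'M[R]_N) : M *m ones = 0 -> M *m Pi = M.
Proof.
move=> M1; rewrite /centering_mx mulmxBr mulmx1 -scalemxAr mulmxA M1.
by rewrite mul0mx scaler0 subr0.
Qed.

Lemma centering_ones : Pi *m ones = 0.
Proof.
rewrite /centering_mx mulmxBl mul1mx -scalemxAl -mulmxA.
have -> : ones^T *m ones = N%:R%:M.
  apply/matrixP => i j; rewrite !ord1 !mxE eqxx mulr1n.
  under eq_bigr => k _ do rewrite !mxE mulr1.
  by rewrite sumr_const card_ord.
rewrite mul_mx_scalar scalerA mulVf ?scale1r ?subrr//.
by rewrite pnatr_eq0 -lt0n.
Qed.

Lemma centering_idem : Pi *m Pi = Pi.
Proof. exact: mul_centering centering_ones. Qed.

Lemma centering_mulE (v : 'cV[R]_N) i :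
  (Pi *m v) i 0 = v i 0 - N%:R^-1 * \sum_j v j 0.
Proof.
rewrite /centering_mx mulmxBl mul1mx -scalemxAl -mulmxA !mxE big_ord1 !mxE mul1r.
by congr (_ - _ * _); apply: eq_bigr => j _; rewrite !mxE mul1r.
Qed.

End Centering.

Section Laplacian.
Variables (R : realType) (N : nat) (e : rel 'I_N).
Hypotheses (e_undirected : undirected_graph e) (e_connected : connected_graph e).
Local Notation L := (laplacian R e).
Local Notation ones := (const_mx 1 : 'cV[R]_N).
Local Notation Pi := (centering_mx R N).

Lemma laplacian_tr : L^T = L.
Proof.
case: e_undirected => esym _; rewrite /laplacian linearB/= tr_diag_mx.
by congr (_ - _); apply/matrixP => i j; rewrite !mxE esym.
Qed.

Lemma laplacian_mulE (v : 'cV[R]_N) i :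
  (L *m v) i 0 = \sum_j (e i j)%:R * (v i 0 - v j 0).
Proof.
rewrite /laplacian mulmxBl mul_diag_mx !mxE -sum1_card natr_sum big_mkcond/=.
rewrite mulr_suml -sumrB; apply: eq_bigr => j _; rewrite !mxE inE mulrBr.
by case: (e i j).
Qed.

(** The Dirichlet form of the graph: each edge is seen from both endpoints. *)
Lemma laplacian_qformE (v : 'cV[R]_N) :
  2 * qform L v = \sum_i \sum_j (e i j)%:R * (v i 0 - v j 0) ^+ 2.
Proof.
case: e_undirected => esym _.
have qE : qform L v = \sum_i \sum_j (e i j)%:R * (v i 0 * (v i 0 - v j 0)).
  rewrite /qform -mulmxA mxE; apply: eq_bigr => i _.
  rewrite mxE laplacian_mulE mulr_sumr; apply: eq_bigr => j _; ring.
rewrite mulrC mulr_natr mulr2n [X in X + _]qE exchange_big/= qE -big_split/=.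
apply: eq_bigr => i _; rewrite -big_split/=; apply: eq_bigr => j _.
rewrite [e j i]esym; ring.
Qed.

Lemma laplacian_possemidef : possemidef L.
Proof.
split=> [|v]; first exact: laplacian_tr.
rewrite -(pmulr_rge0 _ (ltr0n R 2)) laplacian_qformE.
by do 2!apply: sumr_ge0 => ? _; rewrite mulr_ge0 ?sqr_ge0 ?ler0n.
Qed.

Lemma laplacian_ones : L *m ones = 0.
Proof.
apply/colP => i; rewrite laplacian_mulE [RHS]mxE big1// => j _.
by rewrite !mxE subrr mulr0.
Qed.

Lemma laplacian_ker (v : 'cV[R]_N) i j : L *m v = 0 -> v i 0 = v j 0.
Proof.
move=> Lv0; have : 2 * qform L v = 0 by rewrite /qform -mulmxA Lv0 mulmx0 mxE mulr0.
have term_ge0 k l : 0 <= (e k l)%:R * (v k 0 - v l 0) ^+ 2 :> R.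
  by rewrite mulr_ge0 ?sqr_ge0 ?ler0n.
rewrite laplacian_qformE => /psumr_eq0P rows0.
have edge k l : e k l -> v k 0 = v l 0.
  move=> ekl; have /psumr_eq0P row0 := rows0 (fun i _ => sumr_ge0 _ (fun j _ => term_ge0 i j))
    k isT.
  have /eqP := row0 (fun l _ => term_ge0 k l) l isT.
  by rewrite ekl mul1r sqrf_eq0 subr_eq0 => /eqP.
have /connectP[p ep ->] := e_connected i j.
elim: p i ep => //= k p IHp i /andP[eik ekp].
by rewrite (edge _ _ eik); exact: IHp.
Qed.

Lemma mul_laplacian_centering : L *m Pi = L.
Proof. exact: mul_centering laplacian_ones. Qed.

Lemma mul_centering_laplacian : Pi *m L = L.
Proof.
rewrite -[LHS]trmxK trmx_mul centering_tr laplacian_tr.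
by rewrite mul_laplacian_centering laplacian_tr.
Qed.

End Laplacian.

(** * Spectral bounds for functions of the Laplacian *)

Section OrderedSpectrum.
Variables (R : realType) (N : nat) (M : 'M[R]_N) (lam : N.-tuple R).
Hypothesis lamP : ordered_spectrum M lam.

Lemma ordered_spectrum_eigenvalue a : (a \in lam) = eigenvalue M a.
Proof. by case: lamP => _ charM; rewrite eigenvalue_root_char charM root_prod_XsubC. Qed.

Lemma ordered_spectrum_nth_le i j :
  (i <= j)%N -> (j < N)%N -> lam`_i <= lam`_j.
Proof.
case: lamP => lam_sorted _ ij jN.
apply: (sorted_leq_nth le_trans le_refl) => //; rewrite inE size_tuple//.
exact: leq_ltn_trans jN.
Qed.

Lemma ordered_spectrum_le_last a : a \in lam -> a <= lam`_N.-1.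
Proof.
move=> a_lam; have ilt : (index a lam < N)%N.
  by rewrite -[X in (_ < X)%N](size_tuple lam) index_mem.
rewrite -{1}(nth_index 0 a_lam) ordered_spectrum_nth_le//.
  by rewrite -ltnS prednK//; exact: leq_ltn_trans ilt.
by rewrite ltn_predL; exact: leq_ltn_trans ilt.
Qed.

Lemma ordered_spectrum_second_le a : 0 \in lam -> a \in lam -> 0 < a -> lam`_1 <= a.
Proof.
move=> z_lam a_lam a_gt0.
have ilt b : b \in lam -> (index b lam < N)%N.
  by rewrite -[X in (_ < X)%N](size_tuple lam) index_mem.
have first_le0 : lam`_0 <= 0.
  by rewrite -[leRHS](nth_index 0 z_lam) ordered_spectrum_nth_le ?ilt.
rewrite -[leRHS](nth_index 0 a_lam) ordered_spectrum_nth_le ?ilt// lt0n.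
apply/negP => /eqP i0; have := nth_index 0 a_lam; rewrite i0 => a0.
by move: a_gt0; rewrite -a0 ltNge first_le0.
Qed.

End OrderedSpectrum.

Lemma eigenframe_quadratic (R : realType) n p (M : 'M[R]_n) (Z : 'M[R]_(p, n)) d
    a b g v : M^T = M -> Z^T *m Z = 1%:M -> Z *m M = diag_mx d *m Z ->
  qform (a *: (M *m M) + b *: M + g *: 1%:M) v =
  \sum_i (a * d 0 i ^+ 2 + b * d 0 i + g) * (Z *m v) i 0 ^+ 2.
Proof.
move=> Msym ZZ ZM; rewrite !qformD !qformZ.
rewrite -{1}Msym qform_gram !(eigenframe_normsq ZZ) -/(normsq v).
rewrite (eigenframe_normsq ZZ v) (eigenframe_qform ZZ ZM) !normsqE.
rewrite !mulr_sumr -!big_split/=; apply: eq_bigr => i _.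
by rewrite (eigenframe_mul ZM); ring.
Qed.

Lemma eigenframe_eigenvalue (R : realType) n p (M : 'M[R]_n) (Z : 'M[R]_(p, n)) d i :
  Z *m M = diag_mx d *m Z -> row i Z != 0 -> eigenvalue M (d 0 i).
Proof.
move=> ZM Zi; apply/eigenvalueP; exists (row i Z) => //.
by rewrite -row_mul ZM; apply/rowP => j; rewrite mul_diag_mx !mxE.
Qed.

Section LaplacianSpectrum.
Variables (R : realType) (N : nat) (e : rel 'I_N) (lam : N.-tuple R).
Hypotheses (N_gt1 : (1 < N)%N).
Hypotheses (e_undirected : undirected_graph e) (e_connected : connected_graph e).
Local Notation L := (laplacian R e).
Local Notation Pi := (centering_mx R N).
Hypothesis lamP : ordered_spectrum L lam.

Lemma laplacian_spectrum0 : 0 \in lam.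
Proof.
rewrite (ordered_spectrum_eigenvalue lamP); apply/eigenvalueP.
exists (const_mx 1)^T; last first.
  rewrite trmx_const; apply/eqP => /rowP/(_ (Ordinal (ltnW N_gt1))).
  by rewrite !mxE => /eqP; rewrite oner_eq0.
by rewrite -(laplacian_tr R e_undirected) -trmx_mul laplacian_ones trmx0 scale0r.
Qed.

Lemma laplacian_spectrum_ge0 a : a \in lam -> 0 <= a.
Proof.
rewrite (ordered_spectrum_eigenvalue lamP) => /eigenvalueP[w wL w0].
have w0' : w^T != 0 by rewrite -trmx0 (inj_eq trmx_inj).
have [_ /(_ w^T)] := laplacian_possemidef R e_undirected.
rewrite /qform trmxK wL -scalemxAl mxE.
have -> : (w *m w^T) 0 0 = normsq w^T by rewrite /normsq /qform trmxK mulmx1.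
by rewrite pmulr_lge0// normsq_gt0.
Qed.

(** On the complement of the all-ones vector the Laplacian has its spectrum in
    [[lam`_1, lam`_N.-1]]: the frame vectors with eigenvalue [0] are constant,
    because the graph is connected, and are annihilated by the centering. *)
Lemma laplacian_quadratic_possemidef a b g :
  (forall mu, lam`_1 <= mu -> mu <= lam`_N.-1 -> 0 <= a * mu ^+ 2 + b * mu + g) ->
  possemidef (a *: (L *m L) + b *: L + g *: Pi).
Proof.
move=> quad_ge0; have Lsym := laplacian_tr R e_undirected.
have Pisym := centering_tr R N.
split=> [|v].
  rewrite linearD/= linearD/= linearZ/= linearZ/= linearZ/=.
  by rewrite trmx_mul Lsym Pisym.
have -> : a *: (L *m L) + b *: L + g *: Pi =
    Pi^T *m (a *: (L *m L) + b *: L + g *: 1%:M) *m Pi.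
  have := mul_centering_laplacian R e_undirected.
  have := mul_laplacian_centering R e; have := centering_idem R (ltnW N_gt1).
  rewrite Pisym; move: L Pi => M P PP MP PM.
  rewrite !mulmxDr !mulmxDl -!scalemxAr -!scalemxAl mulmx1 !mulmxA.
  by rewrite PM -(mulmxA M) MP PP.
rewrite qform_congr; have [p [Z [d [ZZ ZL]]]] := symmetric_eigenframe Lsym.
rewrite (eigenframe_quadratic _ _ _ _ Lsym ZZ ZL); apply: sumr_ge0 => i _.
have [Zi|Zi] := eqVneq (row i Z) 0.
  by rewrite (eigenframe_row0 _ Zi) expr0n/= mulr0.
have di_lam : d 0 i \in lam.
  by rewrite (ordered_spectrum_eigenvalue lamP) (eigenframe_eigenvalue ZL).
have [di0|di0] := eqVneq (d 0 i) 0; last first.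
  rewrite mulr_ge0 ?sqr_ge0// quad_ge0 ?(ordered_spectrum_le_last lamP)//.
  apply: (ordered_spectrum_second_le lamP laplacian_spectrum0) => //.
  by rewrite lt_def di0 laplacian_spectrum_ge0.
have ker_row : L *m (row i Z)^T = 0.
  by rewrite (eigenframe_eigenvector Lsym ZL) di0 scale0r.
have Zconst j : Z i j = Z i (Ordinal (ltnW N_gt1)).
  have := laplacian_ker e_undirected e_connected j (Ordinal (ltnW N_gt1)) ker_row.
  by rewrite !mxE.
suff -> : (Z *m (Pi *m v)) i 0 = 0 by rewrite expr0n/= mulr0.
rewrite mulmxA mxE big1// => j _.
suff -> : (Z *m Pi) i j = 0 by rewrite mul0r.
rewrite mxE; under eq_bigr => k _ do rewrite Zconst.
rewrite -mulr_sumr; suff -> : \sum_k Pi k j = 0 by rewrite mulr0.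
have /colP/(_ j) := centering_ones R (ltnW N_gt1).
rewrite [LHS]mxE [RHS]mxE => Pi1; rewrite -[RHS]Pi1; apply: eq_bigr => k _.
by rewrite -[in LHS]Pisym [LHS]mxE [const_mx _ _ _]mxE mulr1.
Qed.

End LaplacianSpectrum.

(** Division by zero yields zero, so a vanishing [lN] would make the two bounds
    on [c] contradict each other. *)
Lemma coupling_gain_bounds (R : realFieldType) (l2 lN c : R) :
  0 <= l2 -> l2 <= lN -> 2 / (l2 + lN) <= c -> c < 2 / lN ->
  [/\ 0 < lN, 0 < c, c * lN < 2 & 2 <= c * (l2 + lN)].
Proof.
move=> l2_ge0 l2_le c_ge c_lt.
have lN_gt0 : 0 < lN.
  rewrite lt_def (le_trans l2_ge0 l2_le) andbT; apply/eqP => lN0.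
  move: c_ge c_lt; have -> : l2 = 0 by apply/eqP; rewrite eq_le l2_ge0 -lN0 l2_le.
  by rewrite lN0 addr0 invr0 mulr0 => /le_lt_trans /[apply]; rewrite ltxx.
have s_gt0 : 0 < l2 + lN by rewrite ltr_wpDl.
split=> //.
- by apply: lt_le_trans c_ge; rewrite divr_gt0.
- by rewrite -ltr_pdivlMr.
- by rewrite -ler_pdivrMr.
Qed.

(** * Kronecker products and the dissipation identity *)

Lemma sum_mxtens_index (V : nmodType) N n (f : 'I_(N * n) -> V) :
  \sum_k f k = \sum_i \sum_j f (mxtens_index (i, j)).
Proof.
rewrite pair_bigA/= (reindex (@mxtens_index N n))/=.
  by apply: eq_bigr => -[].
exists (@mxtens_unindex N n) => k _; [exact: mxtens_indexK|exact: mxtens_unindexK].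
Qed.

Lemma agent_tens (R : realType) N n p q (F : 'M[R]_(p, N)) (Y : 'M[R]_(q, n))
    (x : 'cV[R]_(N * n)) i :
  agent ((F *t Y) *m x) i = \sum_j F i j *: (Y *m agent x j).
Proof.
apply/colP => k; rewrite summxE !mxE sum_mxtens_index; apply: eq_bigr => j _.
rewrite !mxE mulr_sumr; apply: eq_bigr => l _.
by rewrite tensmxE !mxE mulrA.
Qed.

Lemma qform_tens1 (R : realType) N n (Y : 'M[R]_n) (x : 'cV[R]_(N * n)) :
  qform (1%:M *t Y) x = \sum_i qform Y (agent x i).
Proof.
rewrite /qform -mulmxA mxE sum_mxtens_index; apply: eq_bigr => i _.
rewrite -mulmxA mxE; apply: eq_bigr => k _; congr (_ * _); first by rewrite !mxE.
have := congr1 (fun u : 'cV_n => u k 0) (agent_tens 1%:M Y x i).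
rewrite [LHS]mxE => ->; rewrite (bigD1 i)//= big1 ?addr0 => [|j ji].
  by rewrite [1%:M i i]mxE eqxx scale1r.
by rewrite [1%:M i j]mxE eq_sym (negPf ji) scale0r.
Qed.

(** Squares can be pulled out of the first factor, which reduces a Kronecker
    quadratic form to the second factor acting on each agent separately. *)
Lemma qform_tens_gram (R : realType) N n p (F : 'M[R]_(p, N)) (Y : 'M[R]_n)
    (x : 'cV[R]_(N * n)) :
  qform ((F^T *m F) *t Y) x = \sum_i qform Y (agent ((F *t 1%:M) *m x) i).
Proof.
rewrite -qform_tens1 -qform_congr trmx_tens trmx1 !tensmx_mul mulmx1 mul1mx.
by rewrite mulmx1.
Qed.

Lemma qform_tens_ge0 (R : realType) N n (X : 'M[R]_N) (Y : 'M[R]_n) x :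
  possemidef X -> possemidef Y -> 0 <= qform (X *t Y) x.
Proof.
move=> /possemidef_gram[p [F ->]] [_ Y_ge0].
by rewrite qform_tens_gram; apply: sumr_ge0 => i _.
Qed.

Section Dissipation.
Variables (R : realType) (N n m : nat) (e : rel 'I_N).
Variables (A : 'M[R]_n) (B : 'M[R]_(n, m)) (Q : 'M[R]_n) (W : 'M[R]_m).
Variables (c lamN : R) (P : 'M[R]_n).
Hypotheses (e_undirected : undirected_graph e).
Hypotheses (Wpos : posdef W) (Psym : P^T = P).
Local Notation L := (laplacian R e).
Local Notation Pi := (centering_mx R N).
Let K := - c *: (invmx W *m B^T *m P).
Let G := P *m B *m invmx W *m B^T *m P.
Let M := network_mx L A B K.

(** The derivative of the Lyapunov function [Pi *t P] along the network is minus
    the running cost, minus the decrease granted by the Riccati inequality on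
    every mode, minus two slack terms.  The slacks, quadratic polynomials
    in the Laplacian tensored with [Q] and [G], are nonnegative as soon as [lamN]
    is the worst value of the Riccati expression among the eigenvalues off the
    all-ones vector. *)
Lemma lyapunov_derivative_identity :
  M^T *m (Pi *t P) + (Pi *t P) *m M =
  - (L *t Q + (L *m L) *t (K^T *m W *m K)
     + Pi *t (- riccati_lhs A B Q W c lamN P)
     + (0 *: (L *m L) + (-1) *: L + lamN *: Pi) *t Q
     + ((- c ^+ 2) *: (L *m L) + (2 * c) *: L
        + (c ^+ 2 * lamN ^+ 2 - 2 * c * lamN) *: Pi) *t G).
Proof.
have [Wsym _] := Wpos; have Wunit := posdef_unitmx Wpos.
have WIsym : (invmx W)^T = invmx W by rewrite trmx_inv Wsym.
have Lsym := laplacian_tr R e_undirected; have Pisym := centering_tr R N.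
have PiL := mul_centering_laplacian R e_undirected.
have Gsym : G^T = G by rewrite /G !trmx_mul trmxK WIsym Psym !mulmxA.
have KWK : K^T *m W *m K = c ^+ 2 *: G.
  have -> : K^T = - c *: (P *m (B *m invmx W)).
    by rewrite /K linearZ/= !trmx_mul trmxK WIsym Psym.
  rewrite /K -!scalemxAl -!scalemxAr.
  rewrite scalerA mulrNN -expr2; congr (_ *: _).
  by rewrite /G !mulmxA -(mulmxA _ (invmx W) W) mulVmx// mulmx1.
have PBK : P *m (B *m K) = - c *: G by rewrite /K -!scalemxAr /G !mulmxA.
have HM : (Pi *t P) *m M = Pi *t (P *m A) + L *t (- c *: G).
  by rewrite /M /network_mx mulmxDr !tensmx_mul mulmx1 PiL PBK.
have MH : M^T *m (Pi *t P) = Pi *t (A^T *m P) + L *t (- c *: G).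
  rewrite -[LHS]trmxK trmx_mul trmx_tens trmxK Pisym Psym HM linearD/= !trmx_tens.
  by rewrite trmx_mul Psym Pisym Lsym linearZ/= Gsym.
rewrite HM MH KWK /riccati_lhs -/G.
move: (L *m L) (A^T *m P) (P *m A) G L Pi => L2 AP PA G' L' Pi'.
apply/matrixP => k l; case: (mxtens_indexP k) => i i'.
case: (mxtens_indexP l) => j j'.
rewrite !mxE !mxtens_indexK/=; ring.
Qed.

End Dissipation.

(** * Quadratic forms along linear trajectories *)

Lemma qformE (R : realType) n (M : 'M[R]_n) v :
  qform M v = \sum_i \sum_j M i j * (v i 0 * v j 0).
Proof.
rewrite /qform -mulmxA mxE; apply: eq_bigr => i _.
rewrite !mxE mulr_sumr; apply: eq_bigr => j _; ring.
Qed.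

Lemma continuous_qform (R : realType) n (M : 'M[R]_n) : continuous (qform M).
Proof.
have -> : qform M = fun v => \sum_i \sum_j M i j * (v i 0 * v j 0).
  by apply/funext => v; exact: qformE.
apply: (@continuous_big _ _ +%R) => [|i _]; first exact: add_continuous.
apply: (@continuous_big _ _ +%R) => [|j _]; first exact: add_continuous.
move=> v; have vi := @coord_continuous R n 1 i 0 v.
have vj := @coord_continuous R n 1 j 0 v.
exact: (cvgM (cvg_cst (M i j)) (cvgM vi vj)).
Qed.

Lemma is_derive_coord (R : realType) d (x : R -> 'cV[R]_d) (t : R)
    (y : 'cV[R]_d) i :
  is_derive t 1 x y -> is_derive t 1 (fun s => x s i 0) (y i 0).
Proof.
move=> [dx xE]; have dxi := (derivable_mxP _ _ _).1 dx i 0.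
split; first exact: dxi.
by rewrite -xE (derive_mx dx) mxE.
Qed.

Lemma is_derive_qform (R : realType) d (M H : 'M[R]_d) (x : R -> 'cV[R]_d)
    (t : R) :
  is_derive t 1 x (M *m x t) ->
  is_derive t 1 (fun s => qform H (x s)) (qform (M^T *m H + H *m M) (x t)).
Proof.
move=> dx; pose y := M *m x t.
have -> : (fun s => qform H (x s)) =
    \sum_i \sum_j H i j *: ((fun s => x s i 0) * (fun s => x s j 0)).
  apply/funext => s; rewrite qformE fct_sumE; apply: eq_bigr => i _.
  by rewrite fct_sumE; apply: eq_bigr.
apply: is_derive_eq.
  apply: is_derive_sum => i; apply: is_derive_sum => j; apply: is_deriveZ.
  by apply: is_deriveM; exact: is_derive_coord dx.
rewrite -/y qformD.
have -> : qform (M^T *m H) (x t) = (y^T *m H *m x t) 0 0.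
  by rewrite /qform /y trmx_mul !mulmxA.
have -> : qform (H *m M) (x t) = ((x t)^T *m H *m y) 0 0.
  by rewrite /qform /y !mulmxA.
rewrite -!mulmxA !mxE -big_split/=; apply: eq_bigr => i _.
rewrite !mxE !mulr_sumr -big_split/=; apply: eq_bigr => j _.
rewrite /GRing.scale/=; ring.
Qed.

(** * Decay and cost of a dissipated quantity *)

(** [V] is nonincreasing, so its decrease over
    [[0, t]] is at least [alpha * V t * t], whence [V t * (1 + alpha * t) <= V 0]. *)
Lemma dissipation_cvg0 (R : realType) (V f : R -> R) (alpha : R) :
  0 < alpha -> (forall t, 0 <= V t) ->
  {within `[0, +oo[, continuous V}%classic ->
  (forall t : R, 0 < t -> is_derive t 1 V (f t)) ->
  (forall t, f t <= - alpha * V t) ->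
  (V t @[t --> +oo%R] --> 0)%classic.
Proof.
move=> alpha_gt0 V_ge0 Vcont dV f_le.
have f_le0 t : f t <= 0.
  by rewrite (le_trans (f_le t))// mulNr oppr_le0 mulr_ge0// ltW.
have mean a b : 0 <= a -> a <= b ->
    exists2 s, s \in `[a, b] & V b - V a = f s * (b - a).
  move=> a0 ab; apply: (MVT_segment ab).
    by move=> s; rewrite in_itv/= => /andP[as_ _]; apply: dV; exact: le_lt_trans as_.
  apply: continuous_subspaceW Vcont => s /=; rewrite !in_itv/= andbT => /andP[as_ _].
  exact: le_trans as_.
have V_nincr a b : 0 <= a -> a <= b -> V b <= V a.
  move=> a0 ab; have [s _ Vs] := mean a b a0 ab.
  by rewrite -subr_le0 Vs mulr_le0_ge0// subr_ge0.
have bound t : 0 <= t -> alpha * t * V t <= V 0.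
  move=> t0; have [s /[!in_itv]/= /andP[s0 st] Vs] := mean 0 t (lexx 0) t0.
  have fs : f s <= - alpha * V t.
    apply: le_trans (f_le s) _; rewrite !mulNr lerN2.
    by apply: ler_wpM2l; [exact: ltW|exact: V_nincr].
  have dec := ler_wpM2r t0 fs; rewrite -[X in f s * X]subr0 -Vs in dec.
  have V_t := V_ge0 t; rewrite mulNr mulNr mulrAC in dec; lra.
apply/cvgrPdist_lt => eps eps_gt0; near=> t.
have t_gt0 : 0 < t by near: t; apply: nbhs_pinfty_gt; exact: num_real.
rewrite sub0r normrN ger0_norm//.
have t_big : V 0 / (alpha * eps) < t by near: t; apply: nbhs_pinfty_gt; exact: num_real.
rewrite ltNge; apply/negP => le_eps.
have := bound t (ltW t_gt0); apply/negP; rewrite -ltNge.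
move: t_big; rewrite ltr_pdivrMr ?mulr_gt0// => /lt_le_trans; apply.
have -> : t * (alpha * eps) = alpha * t * eps by ring.
by rewrite ler_wpM2l// mulr_ge0// ltW.
Unshelve. all: by end_near. Qed.

(** As [V] vanishes at infinity, [V 0] is the improper integral of [- f], its rate
    of decrease. *)
Lemma dissipation_integral_le (R : realType) (V f g : R -> R) :
  {within `[0, +oo[, continuous V}%classic ->
  {within `[0, +oo[, continuous f}%classic ->
  {within `[0, +oo[, continuous g}%classic ->
  (forall t : R, 0 < t -> is_derive t 1 V (f t)) ->
  (forall t, 0 <= g t) -> (forall t, g t <= - f t) ->
  (V t @[t --> +oo%R] --> 0)%classic ->
  (\int[lebesgue_measure]_(t in `[0%R, +oo[) (g t)%:E <= (V 0%R)%:E)%E.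
Proof.
move=> Vcont fcont gcont dV g_ge0 g_le V0.
have fNcont : {within `[0, +oo[, continuous (fun t : R => - f t)}%classic.
  by move=> t; apply: cvgN; exact: fcont.
have measE (h : R -> R) : {within `[0, +oo[, continuous h}%classic ->
    measurable_fun (`[0, +oo[%classic : set R) h.
  by move=> hcont; exact: subspace_continuous_measurable_fun.
have -> : (V 0)%:E = (\int[lebesgue_measure]_(t in `[0%R, +oo[) (- f t)%:E)%E.
  rewrite (@ge0_continuous_FTC2y _ _ (fun t => - V t) 0 0)//.
  - by rewrite -EFinB sub0r opprK.
  - by move=> t _; exact: le_trans (g_le t).
  - by rewrite -oppr0; exact: cvgN.
  - by move=> t t0; have [dVt _] := dV t t0; exact: derivableN.
  - by apply: cvgN; have /continuous_within_itvcyP[] := Vcont.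
  - move=> t; rewrite in_itv/= andbT => t0; have dVt := dV t t0.
    by rewrite derive1E; apply: derive_val.
apply: ge0_le_integral => //.
- by move=> t _; rewrite lee_fin.
- by apply/measurable_EFinP; exact: (measE g gcont).
- by apply/measurable_EFinP; exact: (measE _ fNcont).
- by move=> t _; rewrite lee_fin.
Qed.

Lemma normsq_cvg0 (R : realType) n (u : R -> 'cV[R]_n) (V : R -> R) (beta : R) :
  0 < beta -> (forall t, beta * normsq (u t) <= V t) ->
  (V t @[t --> +oo%R] --> 0)%classic -> (u t @[t --> +oo%R] --> (0 : 'cV[R]_n))%classic.
Proof.
move=> beta_gt0 uV V0; apply/cvgrPdist_le => /= eps eps_gt0; near=> t.
rewrite sub0r normrN /Num.Def.normr/= mx_normrE.
rewrite (bigmax_le _ (ltW eps_gt0))//= => -[i j] _.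
rewrite ord1 -(@ler_pXn2r _ 2) ?nnegrE ?normr_ge0 ?(ltW eps_gt0)//=.
rewrite real_normK ?num_real//; apply: le_trans (sqr_coord_le_normsq _ _) _.
rewrite -(ler_pM2l beta_gt0); apply: le_trans (uV t) _.
have V_small : `|0 - V t| < beta * eps ^+ 2.
  near: t; apply: (cvgrPdist_lt _ _).1 V0 _ _.
  by rewrite mulr_gt0// exprn_gt0.
by rewrite sub0r normrN in V_small; exact: ltW (le_lt_trans (ler_norm _) V_small).
Unshelve. all: by end_near. Qed.

(** * Consensus and cost of the controlled network *)

Lemma possemidef_congr (R : realType) n p (F : 'M[R]_(p, n)) (M : 'M[R]_p) :
  possemidef M -> possemidef (F^T *m M *m F).
Proof.
case=> Msym M_ge0; split=> [|v]; last by rewrite qform_congr.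
by rewrite !trmx_mul trmxK Msym mulmxA.
Qed.

Lemma posdef_dominates (R : realType) n (S P : 'M[R]_n) : posdef S -> P^T = P ->
  exists2 alpha : R, 0 < alpha & forall v, alpha * qform P v <= qform S v.
Proof.
move=> /posdef_ge_normsq[beta beta_gt0 betaP] /symmetric_le_normsq[k k_gt0 kP].
exists (beta / k) => [|v]; first exact: divr_gt0.
apply: le_trans (betaP v); rewrite mulrAC ler_pdivrMr// -mulrA ler_pM2l//.
by rewrite mulrC.
Qed.

(** A vector in the kernel of [P] would only see the nonnegative term in [Q], so
    the strict inequality makes [P] definite. *)
Lemma riccati_posdef (R : realType) n m (A : 'M[R]_n) (B : 'M[R]_(n, m))
    (Q : 'M[R]_n) (W : 'M[R]_m) (c lamN : R) (P : 'M[R]_n) :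
  0 <= lamN -> possemidef Q -> possemidef P ->
  negdef (riccati_lhs A B Q W c lamN P) -> posdef P.
Proof.
move=> lamN_ge0 [_ Q_ge0] Ppsd [_ lhs_lt0]; have [Psym P_ge0] := Ppsd.
split=> // v v0; rewrite lt_def P_ge0 andbT; apply/eqP => /(possemidef_qform0 Ppsd) Pv0.
have := lhs_lt0 v v0; rewrite qformN oppr_gt0 ltNge => /negP; apply.
rewrite /riccati_lhs !qformD !qformZ.
have -> : qform (P *m A) v = qform (A^T *m P) v by rewrite -qform_tr trmx_mul Psym.
have -> : qform (A^T *m P) v = 0 by rewrite /qform -!mulmxA Pv0 !mulmx0 mxE.
have -> : qform (P *m B *m invmx W *m B^T *m P) v = 0.
  by rewrite /qform -!mulmxA Pv0 !mulmx0 mxE.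
by rewrite mulr0 !add0r mulr_ge0.
Qed.

Section ControlledNetwork.
Variables (R : realType) (N n m : nat) (e : rel 'I_N) (lam : N.-tuple R).
Variables (A : 'M[R]_n) (B : 'M[R]_(n, m)) (Q : 'M[R]_n) (W : 'M[R]_m).
Variables (c : R) (P : 'M[R]_n).
Hypotheses (N_gt1 : (1 < N)%N).
Hypotheses (e_undirected : undirected_graph e) (e_connected : connected_graph e).
Hypothesis lamP : ordered_spectrum (laplacian R e) lam.
Hypotheses (Qpsd : possemidef Q) (Wpos : posdef W).
Hypotheses (c_gt0 : 0 < c) (lamN_gt0 : 0 < lam`_N.-1).
Hypothesis c_ge : 2 <= c * (lam`_1 + lam`_N.-1).
Hypotheses (Ppsd : possemidef P).
Hypothesis riccati_lt0 : negdef (riccati_lhs A B Q W c lam`_N.-1 P).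
Local Notation L := (laplacian R e).
Local Notation Pi := (centering_mx R N).
Let K := - c *: (invmx W *m B^T *m P).
Let M := network_mx L A B K.
Let H := Pi *t P.
Let H' := M^T *m H + H *m M.
Let C := L *t Q + (L *m L) *t (K^T *m W *m K).
Let Z (x : 'cV[R]_(N * n)) i := agent ((Pi *t 1%:M) *m x) i.

Let Ppos : posdef P.
Proof. exact: riccati_posdef (ltW lamN_gt0) Qpsd Ppsd riccati_lt0. Qed.

Let qform_centered (Y : 'M[R]_n) x : qform (Pi *t Y) x = \sum_i qform Y (Z x i).
Proof.
rewrite -[in LHS](centering_idem R (ltnW N_gt1)) -[X in X *m _]centering_tr.
exact: qform_tens_gram.
Qed.

Lemma network_lyapunov_ge0 x : 0 <= qform H x.
Proof.
by rewrite qform_centered; apply: sumr_ge0 => i _; case: Ppsd => _; apply.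
Qed.

Lemma network_running_cost_ge0 x : 0 <= qform C x.
Proof.
have Lpsd := laplacian_possemidef R e_undirected.
rewrite qformD addr_ge0 ?qform_tens_ge0//; last first.
  exact: possemidef_congr (posdef_possemidef Wpos).
have -> : L *m L = L^T *m 1%:M *m L by rewrite mulmx1 laplacian_tr.
apply: possemidef_congr; split=> [|v]; first by rewrite trmx1.
exact: normsq_ge0.
Qed.

Lemma network_dissipation x :
  qform H' x <= - (qform C x + qform (Pi *t - riccati_lhs A B Q W c lam`_N.-1 P) x).
Proof.
case: (Ppsd) => Psym _; have Wunit := posdef_unitmx Wpos.
have [Wsym _] := Wpos.
have Gpsd : possemidef (P *m B *m invmx W *m B^T *m P).
  have -> : P *m B *m invmx W *m B^T *m P
      = (invmx W *m B^T *m P)^T *m W *m (invmx W *m B^T *m P).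
    rewrite !trmx_mul trmxK Psym trmx_inv Wsym !mulmxA.
    by rewrite -(mulmxA _ (invmx W) W) mulVmx// mulmx1.
  exact: possemidef_congr (posdef_possemidef Wpos).
rewrite /H' /H /M /K.
rewrite (lyapunov_derivative_identity A B Q c lam`_N.-1 e_undirected Wpos Psym).
rewrite qformN lerN2 -/K -/C [leRHS]qformD [X in _ <= X + _]qformD.
rewrite [X in _ <= X + _ + _]qformD -[leRHS]addrA lerDl.
rewrite addr_ge0 ?qform_tens_ge0//.
  apply: (laplacian_quadratic_possemidef N_gt1 e_undirected e_connected lamP).
  by move=> mu _ mu_le; lra.
apply: (laplacian_quadratic_possemidef N_gt1 e_undirected e_connected lamP).
move=> mu le_mu mu_le.
(* This is where the lower bound on the gain matters: at [mu] and [lam`_N.-1]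
   the parabola [c ^+ 2 * mu ^+ 2 - 2 * c * mu] compares like
   [c * (mu + lam`_N.-1)] and [2]. *)
have -> : - c ^+ 2 * mu ^+ 2 + 2 * c * mu
    + (c ^+ 2 * lam`_N.-1 ^+ 2 - 2 * c * lam`_N.-1)
    = c * ((lam`_N.-1 - mu) * (c * (mu + lam`_N.-1) - 2)) by ring.
rewrite mulr_ge0 ?(ltW c_gt0)// mulr_ge0 ?subr_ge0//.
by apply: le_trans c_ge _; rewrite ler_pM2l// lerD2r.
Qed.

Section Trajectory.
Variable x : R -> 'cV[R]_(N * n).
Hypothesis x_traj : linear_trajectory M x.

Let qform_traj_continuous (Y : 'M[R]_(N * n)) :
  {within `[0, +oo[, continuous (fun t : R => qform Y (x t))}%classic.
Proof.
case: x_traj => xcont _ t.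
by apply: continuous_comp; [exact: xcont|exact: continuous_qform].
Qed.

Let derive_H (t : R) : 0 < t -> is_derive t 1 (fun s => qform H (x s)) (qform H' (x t)).
Proof. by case: x_traj => _ dx t_gt0; exact: is_derive_qform (dx t t_gt0). Qed.

Lemma network_lyapunov_cvg0 : (qform H (x t) @[t --> +oo%R] --> 0)%classic.
Proof.
have [alpha alpha_gt0 alphaP] := posdef_dominates riccati_lt0 (proj1 Ppsd).
apply: (@dissipation_cvg0 _ (fun t : R => qform H (x t))
    (fun t : R => qform H' (x t)) alpha) => //.
  by move=> t; exact: network_lyapunov_ge0.
move=> t; apply: le_trans (network_dissipation _) _; rewrite mulNr lerN2.
rewrite -[leLHS]add0r; apply: lerD; first exact: network_running_cost_ge0.
rewrite !qform_centered mulr_sumr; apply: ler_sum => i _; exact: alphaP.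
Qed.

Lemma network_cost_le : (cost L Q W K x <= (qform H (x 0))%:E)%E.
Proof.
apply: (@dissipation_integral_le _ (fun t : R => qform H (x t))
  (fun t : R => qform H' (x t))).
- exact: qform_traj_continuous.
- exact: qform_traj_continuous.
- exact: qform_traj_continuous.
- exact: derive_H.
- by move=> t; exact: network_running_cost_ge0.
- move=> t; rewrite lerNr; apply: le_trans (network_dissipation _) _.
  rewrite lerN2 lerDl qform_centered; apply: sumr_ge0 => i _.
  by case: (posdef_possemidef riccati_lt0) => _; apply.
- exact: network_lyapunov_cvg0.
Qed.

(** Up to the average of all agents, which cancels in differences, the state of
    agent [i] is its centered state [Z], controlled by the Lyapunov function
    because [P] is definite. *)
Lemma network_consensus i j :
  (agent (x t) i - agent (x t) j @[t --> +oo%R] --> (0 : 'cV[R]_n))%classic.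
Proof.
have [beta beta_gt0 betaP] := posdef_ge_normsq Ppos.
have Z_cvg0 k : (Z (x t) k @[t --> +oo%R] --> (0 : 'cV[R]_n))%classic.
  apply: (normsq_cvg0 beta_gt0 _ network_lyapunov_cvg0) => t.
  apply: le_trans (betaP _) _; rewrite qform_centered (bigD1 k)//= lerDl.
  by apply: sumr_ge0 => l _; case: Ppsd => _; apply.
have ZE y : agent y i - agent y j = Z y i - Z y j.
  have Zk k : Z y k = agent y k - N%:R^-1 *: \sum_l agent y l.
    rewrite /Z agent_tens; apply/colP => r.
    pose v : 'cV[R]_N := \col_l agent y l r 0.
    transitivity ((Pi *m v) k 0).
      rewrite summxE [RHS]mxE; apply: eq_bigr => l _.
      by rewrite mul1mx mxE [v l 0]mxE.
    have -> : (agent y k - N%:R^-1 *: \sum_l agent y l) r 0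
        = agent y k r 0 - N%:R^-1 * (\sum_l agent y l) r 0 by rewrite !mxE.
    rewrite centering_mulE summxE mxE; congr (_ - _ * _).
    by apply: eq_bigr => l _; rewrite mxE.
  by rewrite !Zk opprB addrA subrK.
under eq_cvg do rewrite ZE.
by rewrite -(subrr (0 : 'cV[R]_n)); apply: cvgB; exact: Z_cvg0.
Qed.

End Trajectory.
End ControlledNetwork.

Unset Implicit Arguments.

Theorem theorem10 (R : realType) (N n m : nat)
  (A : 'M[R]_n) (B : 'M[R]_(n, m)) (Q : 'M[R]_n) (W : 'M[R]_m)
  (e : rel 'I_N) (lam : N.-tuple R)
  (x0 : 'cV[R]_(N * n)) (gamma c : R) :
  (1 < N)%N ->
  stabilizable A B ->
  possemidef Q ->
  posdef W ->
  undirected_graph e ->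
  connected_graph e ->
  ordered_spectrum (laplacian R e) lam ->
  0 < gamma ->
  2 / (lam`_1 + lam`_N.-1) <= c ->
  c < 2 / lam`_N.-1 ->
  (exists P : 'M[R]_n,
     possemidef P /\ negdef (riccati_lhs A B Q W c lam`_N.-1 P)) /\
  (forall P : 'M[R]_n,
     possemidef P ->
     negdef (riccati_lhs A B Q W c lam`_N.-1 P) ->
     qform (centering_mx R N *t P) x0 < gamma ->
     let K := - c *: (invmx W *m B^T *m P) in
     reaches_consensus (network_mx (laplacian R e) A B K) /\
     suboptimal (laplacian R e) A B Q W x0 gamma K).
Proof.
move=> N_gt1 stab Qpsd Wpos e_undir e_conn lamP _ c_ge c_lt.
have lam_mem i : (i < N)%N -> lam`_i \in lam.
  by move=> iN; rewrite mem_nth// size_tuple.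
have lam1_ge0 := laplacian_spectrum_ge0 e_undir lamP (lam_mem _ N_gt1).
have lam1_le : lam`_1 <= lam`_N.-1.
  by apply: (ordered_spectrum_nth_le lamP) => //; rewrite -ltnS prednK// ltnW.
have [lamN_gt0 c_gt0 clamN_lt2 c_ge2] := coupling_gain_bounds lam1_ge0 lam1_le c_ge c_lt.
split.
  apply: riccati_inequality_solvable => //; first by case: Qpsd.
  have -> : 2 * c * lam`_N.-1 - c ^+ 2 * lam`_N.-1 ^+ 2
      = c * lam`_N.-1 * (2 - c * lam`_N.-1) by ring.
  by rewrite mulr_gt0 ?subr_gt0// mulr_gt0.
move=> P Ppsd ric_lt0 x0_small K; split.
  move=> x x_traj i j.
  exact: (network_consensus N_gt1 e_undir e_conn lamP Qpsd Wpos c_gt0 lamN_gt0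
            c_ge2 Ppsd ric_lt0 x_traj).
move=> x x_traj x0E.
have := network_cost_le N_gt1 e_undir e_conn lamP Qpsd Wpos c_gt0 c_ge2
  Ppsd ric_lt0 x_traj.
by move=> /le_lt_trans; apply; rewrite lte_fin x0E.
Qed.
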